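(* Let $n\ge 3$ and for each $i=1,\ldots,n$ let $\{m_{i,j}\}_{j=1}^{\infty}$ be a sequence of real numbers with $0<m_{i,1}<m_{i,2}<\cdots$ and $\sum_{j=1}^{\infty}1/m_{i,j}=\infty$. Then any $n$-dimensional distribution function $H$ on $\mathbb{R}_+^n$ is uniquely determined by the countably many values $\{\mathcal{L}_H(s_1,\ldots,s_n): s_i=m_{i,j},\ i=1,\ldots,n,\ j\in\mathbb{N}\}$ of its Laplace–Stieltjes transform (where for each coordinate $i$ the index $j$ ranges independently over $\mathbb{N}$); i.e., two such distributions whose Laplace–Stieltjes transforms agree at all points $(m_{1,j_1},\ldots,m_{n,j_n})$, $j_1,\ldots,j_n\in\mathbb{N}$, coincide.
   Context: For a random vector $(X_1,\ldots,X_n)$ in $[0,\infty)^n$ with joint distribution function $H$, the Laplace–Stieltjes transform is $\mathcal{L}_H(s_1,\ldots,s_n)={\bf E}[\exp(-\sum_{i=1}^n s_iX_i)]$, $s_i>0$. *)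

(* Defs.v *)
From HB Require Import structures.
From mathcomp Require Import all_boot all_order all_algebra.
From mathcomp Require Import all_classical all_reals all_analysis.
Set Implicit Arguments. Unset Strict Implicit. Unset Printing Implicit Defensive.
Import Order.TTheory GRing.Theory Num.Theory.
Local Open Scope ring_scope.
Local Open Scope classical_set_scope.

(* R^n is modelled as n.-tuple R with the product (= Borel) sigma-algebra
   generated by the coordinate projections (library instance). *)

Definition laplace_stieltjes (R : realType) (n : nat)
  (P : probability (n.-tuple R) R) (s : 'I_n -> R) : \bar R :=
  (\int[P]_x (expR (- \sum_(i < n) s i * tnth x i))%:E)%E.

Definition supported_nonneg (R : realType) (n : nat)
  (P : probability (n.-tuple R) R) : Prop :=
  P [set x : n.-tuple R | forall i : 'I_n, 0 <= tnth x i] = 1%E.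

(* Main.v *)
(* The argument approximates one coordinate at a time.  By von Golitschek's
   proof of Muntz' theorem, e^{-qx} is a pointwise limit on [0, +oo[, with
   uniform bounds, of combinations of the e^{-l_j x} as soon as the product of
   the |1 - q / l_j| vanishes.  With l_j = m_j the divergence of sum 1 / m_j
   gives this for 0 < q < m_0; with a sequence l_j increasing to c, the range
   ]0, c[ extends to ]0, 3c/2], hence to all q > 0.  Polynomials in these
   exponentials converge boundedly to the indicators of half-lines, so by
   dominated convergence the two distributions agree on boxes, which form a
   generating pi-system. *)

Require Import Defs.
From HB Require Import structures.
From mathcomp Require Import all_boot all_order all_algebra.
From mathcomp Require Import all_classical all_reals all_analysis.
From mathcomp Require Import measurable_realfun ring lra.
Set Implicit Arguments.
Unset Strict Implicit.
Import Order.TTheory GRing.Theory Num.Theory.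
Import numFieldNormedType.Exports.
Local Open Scope ring_scope.
Local Open Scope classical_set_scope.

(** * Approximation by exponentials through a linear differential equation *)

Lemma is_derive_expRN {R : realType} (s x : R) :
  is_derive x 1 (fun y => expR (- (s * y))) (- s * expR (- (s * x))).
Proof.
have H : is_derive x 1 (fun y : R => - (s * y)) (- s).
  by apply: is_derive_eq; rewrite /GRing.scale/= mulr1.
have dexp := is_derive_expR (- (s * x)).
have := @is_derive1_comp _ expR (fun y => - (s * y)) x _ _ dexp H.
by rewrite mulrC.
Qed.

(* The hypothesis on [g] makes [expR (l * x) * (Q x - C)] nonincreasing. *)
Lemma ode_upper_bound {R : realType} (l C : R) (Q g : R -> R) :
  0 < l -> (forall x : R, is_derive x 1 Q (g x - l * Q x)) -> Q 0 <= C ->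
  (forall x : R, 0 <= x -> g x <= l * C) -> forall x : R, 0 <= x -> Q x <= C.
Proof.
move=> l0 dQ Q0 gC x x0.
(* The double negation lets [is_derive_expRN] apply with exponent [- l]. *)
pose h (y : R) : R := expR (- (- l * y)) * (Q y - C).
have dh (y : R) : is_derive y 1 h (expR (- (- l * y)) * (g y - l * C)).
  have := is_derive_expRN (- l) y; rewrite opprK => dE.
  have dQC : is_derive y 1 (fun z => Q z - C) (g y - l * Q y).
    by have := dQ y => ?; apply: is_derive_eq; rewrite subr0.
  have := is_deriveM dE dQC.
  rewrite /GRing.scale/= => /is_derive_eq; apply; ring.
have : h x <= h 0.
  apply: (@ler0_derive1_nincry _ h 0) => //.
  - move=> y; rewrite in_itv/= andbT => /ltW y0.
    have [_ dhE] := dh y; rewrite derive1E dhE.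
    by rewrite pmulr_rle0 ?expR_gt0// subr_le0 gC.
  - apply: derivable_within_continuous => y _.
    by have [] := dh y.
rewrite /h mulr0 oppr0 expR0 mul1r => h0.
rewrite -subr_le0 -(pmulr_rle0 _ (expR_gt0 (- (- l * x)))).
by rewrite (le_trans h0)// subr_le0.
Qed.

(** Both [Q] and [- Q] obey the one-sided bound with C = |d / l| * B, because l * C = |d| * B
    dominates |d * f|. For [d = l N - q] and [l = l N] the constant |d / l| is the new factor |1 - q
    / l N| of the product. *)
Lemma ode_norm_bound {R : realType} (l d B : R) (Q f : R -> R) :
  0 < l -> (forall x : R, is_derive x 1 Q (d * f x - l * Q x)) -> Q 0 = 0 ->
  (forall x : R, 0 <= x -> `|f x| <= B) ->
  forall x : R, 0 <= x -> `|Q x| <= `|d / l| * B.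
Proof.
move=> l0 dQ Q0 fB x x0.
have B0 : 0 <= B by rewrite (le_trans _ (fB 0 _)).
have E : l * (`|d / l| * B) = `|d| * B.
  by rewrite normrM normfV (gtr0_norm l0) mulrA (mulrC `|d|) mulVKf ?gt_eqF.
have C0 : 0 <= `|d / l| * B by rewrite mulr_ge0.
have df y : 0 <= y -> `|d * f y| <= l * (`|d / l| * B).
  by move=> y0; rewrite E normrM ler_wpM2l// fB.
rewrite ler_norml lerNl; apply/andP; split.
  apply: (@ode_upper_bound _ l _ (fun y => - Q y) (fun y => - (d * f y))) => //.
  - move=> y; have := dQ y => ?; apply: is_derive_eq; ring.
  - by rewrite Q0 oppr0.
  - by move=> y /df; apply: le_trans; rewrite -normrN ler_norm.
apply: (@ode_upper_bound _ l _ Q (fun y => d * f y)) => //.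
- by rewrite Q0.
- by move=> y /df; apply: le_trans; rewrite ler_norm.
Qed.

(* Von Golitschek's recursion: if [f] is the remainder for [N] exponents, the
   solution [Q] of [Q' = (l N - q) f - l N Q], [Q 0 = 0], is again
   [expR (- (q x))] minus a combination of the [expR (- (l j x))], now with
   [j <= N]. *)
Lemma muntz_approx {R : realType} (l : nat -> R) (q : R) (N : nat) :
  0 <= q -> (forall k, 0 < l k) -> injective l ->
  exists a : nat -> R, forall x : R, 0 <= x ->
    `|expR (- (q * x)) - \sum_(j < N) a j * expR (- (l j * x))| <=
    \prod_(j < N) `|1 - q / l j|.
Proof.
move=> q0 l0 linj.
elim: N => [|N [a IH]].
  exists (fun=> 0) => x x0; rewrite !big_ord0 subr0 ger0_norm ?expR_ge0//.
  by rewrite -expR0 ler_expR oppr_le0 mulr_ge0.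
have [qN|qN] := eqVneq q (l N).
  exists (fun j => (j == N)%:R) => x x0.
  rewrite big_ord_recr/= eqxx mul1r qN big1 ?add0r ?subrr ?normr0 ?prodr_ge0//.
  by move=> j _; rewrite ltn_eqF ?mul0r.
(* The solution of [Q' + l N * Q = (l N - q) * E r] with [Q 0 = 0] is [c r * (E r - E (l N))], where
   [E r] is the exponential of rate [r], and [c q = 1]. Collecting the terms in [E (l N)] gives the
   last coefficient [1 - S]. *)
pose c (r : R) := (l N - q) / (l N - r).
pose S := \sum_(j < N) a j * c (l j).
exists (fun j => if j == N then 1 - S else a j * c (l j)) => x x0.
rewrite [X in _ <= X]big_ord_recr/= [X in _ <= X]mulrC.
have lN : l N != 0 by rewrite gt_eqF.
have -> : 1 - q / l N = (l N - q) / l N by rewrite mulrBl divff.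
pose E (s y : R) : R := expR (- (s * y)).
pose Q (y : R) : R := E q y - E (l N) y
   - \sum_(j < N) (a j * c (l j)) * (E (l j) y - E (l N) y).
have QE : expR (- (q * x)) - \sum_(j < N.+1)
    (if j == N :> nat then 1 - S else a j * c (l j)) * expR (- (l j * x)) = Q x.
  rewrite big_ord_recr/= eqxx /Q /E.
  under eq_bigr do rewrite ltn_eqF//.
  under [in RHS]eq_bigr do rewrite mulrBr.
  rewrite sumrB -mulr_suml -/S; ring.
rewrite QE {QE}.
pose f y : R := E q y - \sum_(j < N) a j * E (l j) y.
have dQ (y : R) : is_derive y 1 Q ((l N - q) * f y - l N * Q y).
  have dE s : is_derive y 1 (E s) (- s * E s y) by exact: is_derive_expRN.
  pose h (j : 'I_N) z : R := (a j * c (l j)) * (E (l j) z - E (l N) z).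
  have dh j : is_derive y 1 (h j)
      ((a j * c (l j)) * (- l j * E (l j) y - (- l N * E (l N) y))).
    exact: (is_deriveZ (a j * c (l j)) (is_deriveB (dE (l j)) (dE (l N)))).
  have QE : Q = (E q - E (l N)) - \sum_(j < N) h j.
    by apply/funext => z; rewrite /Q /h !fctE fct_sumE.
  have := is_deriveB (is_deriveB (dE q) (dE (l N))) (is_derive_sum dh).
  rewrite -QE => /is_derive_eq; apply.
  rewrite /f /Q.
  rewrite (eq_bigr (fun i : 'I_N => (l N - q) * (a i * E (l i) y)
    - l N * (a i * c (l i) * (E (l i) y - E (l N) y)))); last first.
    move=> j _; rewrite /c; field.
    by rewrite subr_eq0; apply/eqP => /linj/eqP; rewrite gtn_eqF.
  rewrite sumrB -!mulr_sumr; ring.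
have Q00 : Q 0 = 0.
  rewrite /Q /E !mulr0 oppr0 expR0 subrr sub0r big1 ?oppr0// => j _.
  by rewrite !mulr0 oppr0 expR0 subrr mulr0.
have fB (y : R) : 0 <= y -> `|f y| <= \prod_(j < N) `|1 - q / l j| by exact: IH.
exact: (ode_norm_bound (l0 N) dQ Q00 fB x0).
Qed.

(** * Closure under bounded pointwise limits *)

(* [bp] stands for bounded pointwise convergence, here on [0, +oo[ only. *)
Inductive bp_closure {R : realType} (S : set (R -> R)) : set (R -> R) :=
| bp_zero : bp_closure S (fun=> 0)
| bp_base f : S f -> bp_closure S f
| bp_lin c f g : bp_closure S f -> bp_closure S g ->
    bp_closure S (fun x => c * f x + g x)
| bp_lim (F : nat -> R -> R) (g : R -> R) (M : R) :
    (forall k : nat, bp_closure S (F k)) ->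
    measurable_fun [set: R] g ->
    (forall k (x : R), 0 <= x -> `|F k x| <= M) ->
    (forall x : R, 0 <= x -> F k x @[k --> \oo] --> g x) -> bp_closure S g.

Lemma measurable_expRN {R : realType} (s : R) :
  measurable_fun [set: R] (fun x => expR (- (s * x))).
Proof.
by apply: measurableT_comp => //; apply: measurableT_comp.
Qed.

Lemma expRN_ge0_le1 {R : realType} (s x : R) : 0 <= s -> 0 <= x ->
  0 <= expR (- (s * x)) <= 1.
Proof. by move=> s0 x0; rewrite expR_ge0 -expR0 ler_expR oppr_le0 mulr_ge0. Qed.

Section closure.
Context {R : realType} (S : set (R -> R)).

Lemma bp_sum N (c : nat -> R) (f : nat -> R -> R) :
  (forall j, bp_closure S (f j)) ->
  bp_closure S (fun x => \sum_(j < N) c j * f j x).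
Proof.
move=> Sf; elim: N => [|N IH].
  by under eq_fun do rewrite big_ord0; exact: bp_zero.
under eq_fun do rewrite big_ord_recr/= addrC.
exact: bp_lin.
Qed.

(** A constant sequence in [bp_lim] allows values on the negative half-line to be changed freely, up
    to measurability. *)
Lemma bp_ext f g : bp_closure S f -> measurable_fun setT g ->
  (exists M, forall x : R, 0 <= x -> `|f x| <= M) ->
  (forall x : R, 0 <= x -> f x = g x) -> bp_closure S g.
Proof.
move=> Sf mg [M fM] fg; apply: (@bp_lim _ S (fun=> f) g M) => //.
by move=> x x0; rewrite fg//; exact: cvg_cst.
Qed.

Lemma bp_muntz (l : nat -> R) (q : R) :
  (forall k, 0 < l k) -> injective l -> 0 <= q ->
  (forall k, `|1 - q / l k| <= 1) ->
  \prod_(j < N) `|1 - q / l j| @[N --> \oo] --> (0 : R) ->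
  (forall k, bp_closure S (fun x => expR (- (l k * x)))) ->
  bp_closure S (fun x => expR (- (q * x))).
Proof.
move=> l0 linj q0 q1 prod0 Sl.
have [a aP] := choice (fun N => muntz_approx N q0 l0 linj).
(* The bound 2 is 1 for the target plus 1 for the error, a product of factors at most 1. *)
apply: (@bp_lim _ _ (fun N x => \sum_(j < N) a N j * expR (- (l j * x))) _ 2).
- by move=> N; apply: (@bp_sum N (a N) (fun j x => expR (- (l j * x)))).
- exact: measurable_expRN.
- move=> N x x0; have := aP N x x0.
  have : \prod_(j < N) `|1 - q / l j| <= 1.
    by apply: prodr_ile1 => j _; rewrite normr_ge0 q1.
  have /andP[e0 e1] := expRN_ge0_le1 q0 x0.
  set e := expR _ in e0 e1 *; set s := \sum_(_ < _) _; set p := \prod_(_ < _) _.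
  by rewrite ler_distl ler_norml => p1 /andP[? ?]; apply/andP; split; lra.
move=> x x0; apply/cvgrPdist_le => e e0.
move/cvgrPdist_le: prod0 => /(_ _ e0); apply: filterS => N.
rewrite sub0r normrN ger0_norm ?prodr_ge0// => pe.
exact: le_trans (aP N x x0) pe.
Qed.

(** * Reaching every positive exponent *)

(** Every factor [1 - q / m j] lies between 0 and [expR (- (q / m j))], so the product is at most
    the exponential of [- q] times a partial sum of the divergent series. *)
Lemma bp_expRN_small (m : nat -> R) (q : R) :
  0 < m 0%N -> (forall j, m j < m j.+1) ->
  [series (m j)^-1]_j @ \oo --> +oo ->
  (forall k, bp_closure S (fun x => expR (- (m k * x)))) ->
  0 < q -> q < m 0%N -> bp_closure S (fun x => expR (- (q * x))).
Proof.
move=> m0 mS mdiv Sm q0 qm.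
have minc : increasing_seq m by exact/increasing_seqP.
have mpos k : 0 < m k by rewrite (lt_le_trans m0)// minc.
have qk k : q / m k <= 1.
  by rewrite ler_pdivrMr// mul1r (le_trans (ltW qm))// minc.
have qk0 k : 0 <= q / m k by rewrite divr_ge0// ltW.
have nqk k : `|1 - q / m k| = 1 - q / m k by rewrite ger0_norm// subr_ge0.
apply: (@bp_muntz m) => //.
- exact: inc_inj.
- exact: ltW.
- by move=> k; rewrite nqk lerBlDr lerDl.
apply/cvgrPdist_le => e e0.
move/cvgryPge: mdiv => /(_ (- ln e / q)); apply: filterS => N.
rewrite /series/= big_mkord ler_pdivrMr// => SN.
rewrite sub0r normrN ger0_norm ?prodr_ge0//.
have -> : e = expR (ln e) by rewrite lnK.
have : \prod_(j < N) `|1 - q / m j| <= \prod_(j < N) expR (- (q / m j)).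
  by apply: ler_prod => j _; rewrite normr_ge0/= nqk expR_ge1Dx.
move=> /le_trans; apply.
by rewrite -expR_sum ler_expR sumrN -mulr_sumr mulrC lerNl.
Qed.

Lemma bp_expRN_step (c q : R) : 0 < c ->
  (forall s : R, 0 < s -> s < c -> bp_closure S (fun x => expR (- (s * x)))) ->
  c <= q -> q <= c * (3 / 2) -> bp_closure S (fun x => expR (- (q * x))).
Proof.
move=> c0 Sc cq qc.
(* These distinct exponents stay in [9c/10, c[, so q / l k lies between 1 and (3/2) / (9/10) = 5/3.
   Each factor is then at most 2/3 and the product decays geometrically. *)
pose l k : R := c * (1 - 10^-1 * k.+1%:R^-1).
have lb k : c * (9 / 10) <= l k /\ l k < c.
  rewrite /l; have : 0 < (k.+1%:R : R)^-1 by rewrite invr_gt0.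
  have : (k.+1%:R : R)^-1 <= 1 by rewrite invf_le1// ler1n.
  by move: _^-1 => u u0 u1; nra.
have l0 k : 0 < l k by have [+ _] := lb k; nra.
have b k : `|1 - q / l k| <= 2 / 3.
  have [l1 l2] := lb k.
  have h1 : 1 <= q / l k by rewrite ler_pdivlMr// mul1r; lra.
  have h2 : q / l k <= 5 / 3 by rewrite ler_pdivrMr//; nra.
  by rewrite ler_norml; apply/andP; split; lra.
apply: (@bp_muntz l) => //.
- have tenV : (10^-1 : R) != 0 by rewrite invr_neq0.
  move=> i j /(mulfI (lt0r_neq0 c0))/addrI/oppr_inj/(mulfI tenV)/invr_inj/eqP.
  by rewrite eqr_nat => /eqP[].
- by lra.
- by move=> k; rewrite (le_trans (b k))//; lra.
- apply: (@squeeze_cvgr _ _ _ _ (fun=> 0) (fun N => (2 / 3) ^+ N)).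
  + apply: nearW => N; rewrite prodr_ge0//=.
    rewrite -[X in _ <= _ ^+ X]card_ord -prodr_const.
    by apply: ler_prod => j _; rewrite normr_ge0 b.
  + exact: cvg_cst.
  + by apply: cvg_expr; rewrite ger0_norm; lra.
by move=> k; apply: Sc => //; case: (lb k).
Qed.

Lemma bp_expRN_all (c : R) : 0 < c ->
  (forall s : R, 0 < s -> s < c -> bp_closure S (fun x => expR (- (s * x)))) ->
  forall s : R, 0 < s -> bp_closure S (fun x => expR (- (s * x))).
Proof.
move=> c0 Sc.
(* Each step gains the fixed length [c / 2], at most half of the current endpoint and so within
   reach of [bp_expRN_step]; the Archimedean property then covers all [s]. *)
have H (k : nat) (s : R) : 0 < s -> s < c + k%:R * (c / 2) ->
    bp_closure S (fun x => expR (- (s * x))).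
  elim: k s => [|k IH] s s0; first by rewrite mul0r addr0; exact: Sc.
  move=> sk; have [|sc] := ltP s (c + k%:R * (c / 2)); first exact: IH.
  have k0 : 0 <= k%:R * (c / 2) by rewrite mulr_ge0// divr_ge0// ltW.
  apply: (bp_expRN_step _ IH sc); first by lra.
  by move: sk; rewrite -natr1; lra.
move=> s s0; apply: (H (Num.bound (s / (c / 2)))) => //.
have c20 : 0 < c / 2 by lra.
have := archi_boundP (divr_ge0 (ltW s0) (ltW c20)).
by rewrite ltr_pdivrMr//; lra.
Qed.

(** * From exponentials to indicators of half-lines *)

Hypothesis SE : forall s : R, 0 < s -> bp_closure S (fun x => expR (- (s * x))).

Lemma bp_one : bp_closure S (fun=> 1).
Proof.
apply: (@bp_lim _ _ (fun k x => expR (- (k.+1%:R^-1 * x))) _ 1) => //.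
- by move=> k; apply: SE; rewrite invr_gt0.
- move=> k x x0; rewrite ger0_norm ?expR_ge0//.
  have k0 : 0 <= (k.+1%:R : R)^-1 by rewrite invr_ge0.
  by have /andP[] := expRN_ge0_le1 k0 x0.
move=> x x0; rewrite -[in X in _ --> X]expR0.
apply: continuous_cvg; first exact: continuous_expR.
rewrite -oppr0 -[in X in _ --> - X](mul0r x).
by apply: cvgN; apply: cvgMl; exact: cvg_harmonic.
Qed.

Lemma bp_expRN_ge0 (s : R) : 0 <= s -> bp_closure S (fun x => expR (- (s * x))).
Proof.
rewrite le_eqVlt => /predU1P[<-|]; last exact: SE.
by under eq_fun do rewrite mul0r oppr0 expR0; exact: bp_one.
Qed.

(** The factor of rate [t] makes the induction close without products in the closure: one more
    factor [1 - expR (- (s * x))] yields a difference of the cases [t] and [t + s]. *)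
Lemma bp_expRN_poly (K : nat) (s t : R) : 0 <= s -> 0 <= t ->
  bp_closure S (fun x => expR (- (t * x)) * (1 - expR (- (s * x))) ^+ K).
Proof.
move=> s0; elim: K t => [|K IH] t t0.
  by under eq_fun do rewrite expr0 mulr1; exact: bp_expRN_ge0.
rewrite (_ : (fun _ => _) = fun x =>
   (-1) * (expR (- ((t + s) * x)) * (1 - expR (- (s * x))) ^+ K) +
   expR (- (t * x)) * (1 - expR (- (s * x))) ^+ K).
  by apply: bp_lin; apply: IH => //; rewrite addr_ge0.
by apply/funext => x; rewrite mulrDl opprD expRD exprS; ring.
Qed.

Lemma bernoulli_onem (z : R) (M : nat) : 0 <= z <= 1 ->
  1 - M%:R * z <= (1 - z) ^+ M.
Proof.
move=> /andP[z0 z1]; elim: M => [|M IH]; first by rewrite mul0r subr0 expr0.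
have p1 : (1 - z) ^+ M <= 1 by rewrite exprn_ile1//; lra.
rewrite exprS -natr1; set p := (1 - z) ^+ M in IH p1 *.
have : z * p <= z by rewrite ler_piMr.
by lra.
Qed.

(** This rearranges [t ^+ 2 / 2 <= expR t]. *)
Lemma expRN_le_inv (t : R) : 0 < t -> t * expR (- t) <= 2 / t.
Proof.
move=> t0; have := @expR_ge1Dxn _ t 1 (ltW t0).
rewrite (_ : 2`! = 2)// expRN => h.
rewrite ler_pdivrMr ?expR_gt0// mulrAC ler_pdivlMr//.
by move: h; rewrite expr2; nra.
Qed.

(* With [N * expR (N * a) < M <= N * expR (N * a) + 1], the function
   [(1 - expR (- (N * x))) ^+ M] tends to the indicator of [a < x]: the product
   [M * expR (- (N * x))] tends to [0] for [a < x] and is at least [N] for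
   [x <= a], so that the endpoint falls on the right side. *)
Lemma bp_ray (a : R) : bp_closure S \1_(`]a, +oo[%classic).
Proof.
have mray : measurable_fun [set: R] (\1_(`]a, +oo[%classic) : R -> R).
  exact: measurable_indic.
have [a0|a0] := ltP a 0.
  apply: (bp_ext bp_one) => //; first by exists 1 => x x0; rewrite normr1.
  by move=> x x0; rewrite indicE mem_set//= in_itv/= andbT (lt_le_trans a0).
pose N n : R := n.+1%:R.
pose M n := (Num.truncn (N n * expR (N n * a))).+1.
have N0 n : 0 < N n by rewrite ltr0n.
have N1 n : 1 <= N n by rewrite ler1n.
apply: (@bp_lim _ _ (fun n x =>
   expR (- (0 * x)) * (1 - expR (- (N n * x))) ^+ M n) _ 1) => //.
- by move=> n; apply: bp_expRN_poly => //; exact: ltW.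
- move=> n x x0; rewrite mul0r oppr0 expR0 mul1r.
  have /andP[z0 z1] := expRN_ge0_le1 (ltW (N0 n)) x0.
  by rewrite normrX ger0_norm ?exprn_ile1//; lra.
move=> x x0; under eq_fun do rewrite mul0r oppr0 expR0 mul1r.
have z01 n := expRN_ge0_le1 (ltW (N0 n)) x0.
have MNa n : N n * expR (N n * a) < (M n)%:R by rewrite truncnS_gt.
have [ax|xa] := ltP a x.
  rewrite indicE mem_set/=; last by rewrite in_itv/= ax.
  pose d := x - a; have d0 : 0 < d by rewrite subr_gt0.
  (* With z = [expR (- (N n * x))], Bernoulli gives the lower bound 1 - M z, and M z is at most N
     e^(-Nd) + e^(-Nx). As d <= x and 1 <= N, both terms are at most 2 / (d^2 N), whence the
     constant 4. *)
  apply: (@squeeze_cvgr _ _ _ _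
    (fun n => 1 - 4 / d ^+ 2 * harmonic n) (fun=> 1)).
  - apply: nearW => n; have /andP[z0 z1] := z01 n.
    rewrite exprn_ile1 ?andbT; [|lra..].
    rewrite (le_trans _ (bernoulli_onem _ (z01 n)))// lerB//.
    have ML : (M n)%:R <= N n * expR (N n * a) + 1.
      rewrite /M -natr1 lerD2r.
      have Na0 := mulr_gt0 (N0 n) (expR_gt0 (N n * a)).
      by have /andP[] := truncn_itv (ltW Na0).
    rewrite (le_trans (ler_wpM2r z0 ML))// mulrDl mul1r.
    rewrite -[X in X + _ <= _]mulrA -expRD -mulrBr -opprB mulrN -/d.
    have e1 : expR (- (N n * x)) <= N n * expR (- (N n * d)).
      apply: (@le_trans _ _ (expR (- (N n * d)))).
        by rewrite ler_expR lerN2 ler_pM2l// lerBlDr lerDl.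
      by rewrite ler_peMl ?expR_ge0.
    have e2 := expRN_le_inv (mulr_gt0 (N0 n) d0).
    have e3 : N n * expR (- (N n * d)) <= 2 / d ^+ 2 / N n.
      rewrite -(ler_pM2r d0) mulrAC (le_trans e2)//.
      rewrite le_eqVlt; apply/orP; left; apply/eqP.
      by field; rewrite !gt_eqF.
    rewrite (_ : 4 / d ^+ 2 * harmonic n = 2 / d ^+ 2 / N n + 2 / d ^+ 2 / N n).
      exact: lerD e3 (le_trans e1 e3).
    rewrite (_ : harmonic n = (N n)^-1)//; field.
    by rewrite !gt_eqF.
  - rewrite -[in X in _ --> X](subr0 1) -[in X in _ - X](mulr0 (4 / d ^+ 2)).
    by apply: cvgB; [exact: cvg_cst|apply: cvgMr; exact: cvg_harmonic].
  - exact: cvg_cst.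
rewrite indicE memNset/=; last by rewrite in_itv/= ltNge xa.
(* Here (1 - z)^M <= e^(-Mz), and e^(Mz) >= Mz >= N e^(N(a - x)) >= N = n + 1. *)
apply: (@squeeze_cvgr _ _ _ _ (fun=> 0) harmonic).
- apply: nearW => n; have /andP[z0 z1] := z01 n.
  rewrite exprn_ge0/=; last by lra.
  set z := expR _ in z0 z1 *.
  have : (1 - z) ^+ M n <= expR (- z) ^+ M n.
    by rewrite lerXn2r ?nnegrE ?expR_ge0 ?expR_ge1Dx//; lra.
  move=> /le_trans; apply; rewrite -expRM_natl mulrN expRN.
  rewrite lef_pV2 ?posrE ?expR_gt0 ?ltr0n//.
  rewrite (le_trans _ (expR_ge1Dx _))// -[leLHS]add0r lerD//.
  have h : N n * expR (N n * a) * z <= (M n)%:R * z by rewrite ler_wpM2r// ltW.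
  apply: le_trans h; rewrite -mulrA -expRD -mulrBr ler_peMr ?(ltW (N0 n))//.
  by rewrite -expR0 ler_expR mulr_ge0 ?(ltW (N0 n))// subr_ge0.
- exact: cvg_cst.
- exact: cvg_harmonic.
Qed.

End closure.

(** * Equality of integrals passes to the closure *)

(** The bound is asked only on [[0, +oo[], since decaying exponentials are unbounded on the negative
    half-line. *)
Definition nonneg_bounded_measurable {R : realType} (h : R -> R) :=
  measurable_fun [set: R] h /\ exists M, forall x : R, 0 <= x -> `|h x| <= M.

Lemma bp_nonneg_bounded_measurable {R : realType} (S : set (R -> R)) :
  S `<=` nonneg_bounded_measurable ->
  bp_closure S `<=` nonneg_bounded_measurable.
Proof.
move=> SB h; elim=> {h} [|h /SB//|c f g _ [mf [M fM]] _ [mg [M' gM']]|].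
- by split=> //; exists 0 => x _; rewrite normr0.
- split; first by apply: measurable_funD => //; apply: measurable_funM.
  exists (`|c| * M + M') => x x0.
  by rewrite (le_trans (ler_normD _ _))// normrM lerD ?ler_wpM2l ?fM ?gM'.
move=> F g M _ IH mg FM Fg; split=> //; exists M => x x0.
have c : `|F k x| @[k --> \oo] --> `|g x| by apply: cvg_norm; exact: Fg.
rewrite -(cvg_lim _ c)//; apply: limr_le; first exact: cvgP c.
by apply: nearW => k; exact: FM.
Qed.

Section bp_integral.
Context d (T : measurableType d) {R : realType} (P1 P2 : probability T R).
Variables (D : set T) (X W : T -> R) (B : R).
Hypotheses (mD : measurable D) (mX : measurable_fun [set: T] X).
Hypotheses (mW : measurable_fun [set: T] W).
Hypotheses (X0 : forall x, D x -> 0 <= X x) (WB : forall x, D x -> `|W x| <= B).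

Lemma integrable_comp_mul (P : probability T R) h : nonneg_bounded_measurable h ->
  P.-integrable D (EFin \o (fun x => h (X x) * W x)).
Proof.
move=> [mh [M hM]]; apply: measurable_bounded_integrable => //.
- by rewrite (le_lt_trans (probability_le1 _ _))// ltry.
- apply: measurable_funS (_ : measurable_fun [set: T] _) => //.
  by apply: measurable_funM => //; exact: measurableT_comp.
- exists (M * B); split; first exact: num_real.
  move=> y My x Dx /=; apply: le_trans (ltW My).
  rewrite normrM ler_pM ?hM ?WB//.
  exact: X0.
Qed.

(** Linearity settles [bp_lin]; dominated convergence with the constant [M * B] settles [bp_lim]. In
    the application [X] is one coordinate and [W] the product of the factors in the others. *)
Lemma bp_integral_eq (S : set (R -> R)) : S `<=` nonneg_bounded_measurable ->
  (forall h, S h -> (\int[P1]_(x in D) (h (X x) * W x)%:E =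
                     \int[P2]_(x in D) (h (X x) * W x)%:E)%E) ->
  forall h, bp_closure S h -> (\int[P1]_(x in D) (h (X x) * W x)%:E =
                     \int[P2]_(x in D) (h (X x) * W x)%:E)%E.
Proof.
move=> SB SE h; elim=> {h} [|h /SE//|c f g Sf IHf Sg IHg|F g M SF IH mg FM Fg].
- by under eq_integral do rewrite mul0r;
    under [RHS]eq_integral do rewrite mul0r; rewrite !integral0.
- have lin (P : probability T R) :
      (\int[P]_(x in D) ((c * f (X x) + g (X x)) * W x)%:E =
       c%:E * \int[P]_(x in D) (f (X x) * W x)%:E +
       \int[P]_(x in D) (g (X x) * W x)%:E)%E.
    have If := integrable_comp_mul P (bp_nonneg_bounded_measurable SB Sf).
    have Ig := integrable_comp_mul P (bp_nonneg_bounded_measurable SB Sg).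
    rewrite -integralZl// -integralD//; last exact: integrableZl.
    by apply: eq_integral => x _; rewrite mulrDl EFinD -mulrA EFinM.
  by rewrite !lin IHf IHg.
- have cvgI (P : probability T R) :
      (\int[P]_(x in D) (F k (X x) * W x)%:E @[k --> \oo] -->
       \int[P]_(x in D) (g (X x) * W x)%:E)%E.
    have := @dominated_convergence _ _ _ P D mD
      (fun k x => (F k (X x) * W x)%:E) (fun x => (g (X x) * W x)%:E)
      (cst (M * B)%:E).
    case=> //.
    + move=> k; have [+ _] := bp_nonneg_bounded_measurable SB (SF k) => mF.
      apply: measurable_funS (_ : measurable_fun [set: T] _) => //.
      apply/measurable_EFinP; apply: measurable_funM => //.
      exact: measurableT_comp.
    + apply: measurable_funS (_ : measurable_fun [set: T] _) => //.
      apply/measurable_EFinP; apply: measurable_funM => //.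
      exact: measurableT_comp.
    + apply: aeW => x Dx; apply: cvg_EFin; first exact: nearW.
      by apply: cvgMl; apply: Fg; exact: X0.
    + apply: (@measurable_bounded_integrable _ _ _ _ (cst (M * B))) => //.
        by rewrite (le_lt_trans (probability_le1 _ _))// ltry.
      exact: bounded_cst.
    + apply: aeW => x k Dx; rewrite lee_fin normrM ler_pM// ?WB//.
      by apply: FM; exact: X0.
  have := cvgI P1; under eq_fun do rewrite IH; move=> cvg1.
  by apply: cvg_unique cvg1 (cvgI P2).
Qed.

End bp_integral.

(** * Product functions on the orthant *)

Section orthant.
Context {R : realType} (n : nat).

Definition orthant : set (n.-tuple R) := [set x | forall i, 0 <= tnth x i].

Definition box (J : 'I_n -> set R) : set (n.-tuple R) :=
  [set x | forall i, J i (tnth x i)].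

Lemma measurable_box J : (forall i, measurable (J i)) -> measurable (box J).
Proof.
move=> mJ; rewrite (_ : box J =
    \big[setI/setT]_(i < n) ((@tnth n R)^~ i @^-1` J i)).
  apply: bigsetI_measurable => i _; rewrite -[X in measurable X]setTI.
  exact: measurable_tnth.
by rewrite -bigcap_seq; apply/seteqP; split=> x /= Jx i;
  [move=> _; exact: Jx|apply: Jx; rewrite /= mem_index_enum].
Qed.

Lemma measurable_orthant : measurable orthant.
Proof.
rewrite (_ : orthant = box (fun=> `[0, +oo[%classic)).
  by apply: measurable_box => i; exact: measurable_itv.
by apply/seteqP; split=> x Dx i; have := Dx i; rewrite /= in_itv/= andbT.
Qed.

Definition tuple_prod (f : 'I_n -> R -> R) (x : n.-tuple R) : R :=
  \prod_(i < n) f i (tnth x i).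

Lemma bp_tuple_prod_eq (P1 P2 : probability (n.-tuple R) R)
    (S : 'I_n -> set (R -> R)) :
  (forall i, S i `<=` nonneg_bounded_measurable) ->
  (forall f, (forall i, S i (f i)) ->
    (\int[P1]_(x in orthant) (tuple_prod f x)%:E =
     \int[P2]_(x in orthant) (tuple_prod f x)%:E)%E) ->
  forall f, (forall i, bp_closure (S i) (f i)) ->
    (\int[P1]_(x in orthant) (tuple_prod f x)%:E =
     \int[P2]_(x in orthant) (tuple_prod f x)%:E)%E.
Proof.
move=> SB SE f Sf.
(* Factors are freed one by one: the first [k] range over the closures, the others over the base
   sets. *)
suff H (k : nat) g : (forall i : 'I_n, if (i < k)%N then bp_closure (S i) (g i)
    else S i (g i)) ->
    (\int[P1]_(x in orthant) (tuple_prod g x)%:E =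
     \int[P2]_(x in orthant) (tuple_prod g x)%:E)%E.
  by apply: (H n) => i; rewrite ltn_ord.
elim: k g => [|k IH] g Sg; first by apply: SE => i; exact: Sg.
have [nk|kn] := leqP n k.
  apply: IH => i; have := Sg i.
  by rewrite !(leq_trans (ltn_ord i))// (leq_trans nk).
pose i0 := Ordinal kn.
have gB i : nonneg_bounded_measurable (g i).
  have := Sg i; case: ifPn => _; last exact: SB.
  by apply: bp_nonneg_bounded_measurable; exact: SB.
have [M gM] := choice (fun i => (gB i).2).
pose W (x : n.-tuple R) := \prod_(j < n | j != i0) g j (tnth x j).
have intE (P : probability (n.-tuple R) R) f' :
    (forall j, j != i0 -> f' j = g j) ->
    (\int[P]_(x in orthant) (tuple_prod f' x)%:E =
     \int[P]_(x in orthant) (f' i0 (tnth x i0) * W x)%:E)%E.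
  move=> f'g; apply: eq_integral => x _; rewrite /tuple_prod (bigD1 i0)//=.
  by congr (_ * _)%:E; apply: eq_bigr => j /f'g ->.
have mW : measurable_fun [set: n.-tuple R] W.
  rewrite /W; under eq_fun do rewrite -big_filter.
  apply: measurable_prod => j _; apply: measurableT_comp.
    by have [] := gB j.
  exact: measurable_tnth.
have WB x : orthant x -> `|W x| <= \prod_(j < n | j != i0) M j.
  move=> Dx; rewrite /W normr_prod; apply: ler_prod => j _.
  by rewrite normr_ge0 gM.
rewrite !(intE _ g)//.
apply: (bp_integral_eq measurable_orthant (measurable_tnth i0) mW
  (fun x Dx => Dx i0) WB (SB i0)); last by have := Sg i0; rewrite ltnSn.
(* With a base function in position [i0 = k], only the first [k] factors are free, so the induction
   hypothesis applies. *)
move=> h Sh; pose f' j := if j == i0 then h else g j.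
have f'g j : j != i0 -> f' j = g j by rewrite /f' => /negPf ->.
have := intE _ f' f'g; rewrite [f' i0]/f' eqxx => intf'.
rewrite -!intf'.
apply: IH => i; rewrite /f'.
have [->|ii0] := eqVneq i i0; first by rewrite ltnn.
have := Sg i; rewrite ltnS leq_eqVlt.
by rewrite -val_eqE/= in ii0; rewrite (negPf ii0).
Qed.

(** * A generating pi-system of boxes *)

(** The full line is allowed so that a box can constrain a single coordinate and the whole space is
    a box. *)
Definition ray_or_full (J : set R) :=
  J = setT \/ exists a, J = `]a, +oo[%classic.

Definition ray_boxes : set (set (n.-tuple R)) :=
  [set A | exists2 J, (forall i, ray_or_full (J i)) & A = box J].

Lemma measurable_ray_or_full J : ray_or_full J -> measurable J.
Proof. by move=> [->|[a ->]]; [exact: measurableT|exact: measurable_itv]. Qed.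

Lemma ray_boxes_setI : setI_closed ray_boxes.
Proof.
move=> _ _ [J rJ ->] [K rK ->]; exists (fun i => J i `&` K i); last first.
  apply/seteqP; split=> x /=; first by move=> [Jx Kx] i; split.
  by move=> JKx; split=> i; have [] := JKx i.
move=> i; have [->|[a ->]] := rJ i; first by rewrite setTI.
have [->|[b ->]] := rK i; first by rewrite setIT; right; exists a.
right; exists (Num.max a b); apply/seteqP; split=> x /=;
  rewrite !in_itv/= !andbT gt_max; first by move=> [-> ->].
by move=> /andP[].
Qed.

(** For the harder inclusion, the identity out of the generated sigma-algebra is measurable: the
    preimage of a ray under a coordinate is a box with all other sides full. *)
Lemma measurable_ray_boxes :
  (measurable : set (set (n.-tuple R))) = <<s ray_boxes >>.
Proof.
apply/seteqP; split; last first.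
  apply: smallest_sub; first exact: sigma_algebra_measurable.
  move=> _ [J rJ ->]; apply: measurable_box => i.
  exact: measurable_ray_or_full.
have mid : measurable_fun [set: g_sigma_algebraType ray_boxes]
    (fun x : g_sigma_algebraType ray_boxes => (x : n.-tuple R)).
  apply/measurable_fun_tnthP => i.
  apply: (measurability _ (RGenOInfty.measurableE R)).
  move=> _ [_ [a ->] <-]; apply: sub_sigma_algebra.
  exists (fun j => if j == i then `]a, +oo[%classic else setT).
    by move=> j; case: ifP => _; [right; exists a|left].
  rewrite setTI; apply/seteqP; split=> x /=.
    by move=> xa j; case: eqP => // ->.
  by move=> /(_ i); rewrite eqxx.
by move=> A mA; have := mid measurableT A mA; rewrite setTI.
Qed.

(** * Transforms and box probabilities as integrals of products *)

Lemma orthant_compl0 (P : probability (n.-tuple R) R) :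
  supported_nonneg P -> P (~` orthant) = 0%E.
Proof.
move=> PD; rewrite probability_setC; last exact: measurable_orthant.
by rewrite [P _]PD subee.
Qed.

Lemma laplace_stieltjesE (P : probability (n.-tuple R) R) (s : 'I_n -> R) :
  supported_nonneg P ->
  laplace_stieltjes P s = (\int[P]_(x in orthant)
    (tuple_prod (fun i y => expR (- (s i * y))) x)%:E)%E.
Proof.
move=> PD; rewrite /laplace_stieltjes.
have E x : expR (- (\sum_(i < n) s i * tnth x i)) =
    tuple_prod (fun i y => expR (- (s i * y))) x.
  by rewrite -sumrN expR_sum.
have m : measurable_fun [set: n.-tuple R]
    (fun x => expR (- (\sum_(i < n) s i * tnth x i))).
  apply: (eq_measurable_fun _ (fun x _ => esym (E x))).
  apply: measurable_prod => i _.
  apply: (measurableT_comp (measurable_expRN (s i))).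
  exact: measurable_tnth.
rewrite (@ge0_negligible_integral _ _ _ P setT (~` orthant)).
- by rewrite setTD setCK; apply: eq_integral => x _; rewrite E.
- by apply: measurableC; exact: measurable_orthant.
- exact: measurableT.
- exact/measurable_EFinP.
- by move=> x _; rewrite lee_fin expR_ge0.
- exact: orthant_compl0.
Qed.

Lemma probability_boxE (P : probability (n.-tuple R) R) (J : 'I_n -> set R) :
  supported_nonneg P -> (forall i, measurable (J i)) ->
  P (box J) = (\int[P]_(x in orthant)
    (tuple_prod (fun i => \1_(J i)) x)%:E)%E.
Proof.
move=> PD mJ; have mb := measurable_box mJ; have mD := measurable_orthant.
(* The part of the box outside the orthant is null; on the rest, the indicator of the box is the
   product of those of its sides. *)
rewrite (measureDI P mb mD) [X in (X + _)%E](_ : _ = 0%E) ?add0e; last first.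
  apply: (subset_measure0 _ _ _ (orthant_compl0 PD)).
  - exact: measurableD.
  - exact: measurableC.
  - by move=> x [].
transitivity (\int[P]_(x in orthant) (\1_(box J) x)%:E)%E.
  by rewrite integral_indic.
apply: eq_integral => x _; congr (_%:E).
rewrite /tuple_prod indicE; have [Jx|/existsNP[i Jxi]] := pselect (box J x).
  by rewrite mem_set// big1// => i _; rewrite indicE mem_set.
rewrite memNset; last by move=> /(_ i).
by rewrite (bigD1 i)//= indicE memNset// mul0r.
Qed.

End orthant.

(** * Uniqueness of the distribution *)

Lemma bp_muntz_ray {R : realType} (m : nat -> R) (J : set R) :
  0 < m 0%N -> (forall j, m j < m j.+1) ->
  [series (m j)^-1]_j @ \oo --> +oo -> ray_or_full J ->
  bp_closure [set f | exists k, f = fun x => expR (- (m k * x))] \1_J.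
Proof.
move=> m0 mS mdiv.
set S := [set f | _]; have Sm k : bp_closure S (fun x => expR (- (m k * x))).
  by apply: bp_base; exists k.
have SE := bp_expRN_all m0 (fun s s0 sm => bp_expRN_small m0 mS mdiv Sm s0 sm).
move=> [->|[a ->]]; last exact: bp_ray.
by rewrite indicT; exact: bp_one.
Qed.

Theorem theorem5 (R : realType) (n : nat) (hn : (3 <= n)%N)
  (m : 'I_n -> nat -> R)
  (m_pos : forall i, 0 < m i 0%N)
  (m_incr : forall i j, m i j < m i j.+1)
  (m_div : forall i, [series (m i j)^-1]_j @ \oo --> +oo)
  (P1 P2 : probability (n.-tuple R) R)
  (hP1 : supported_nonneg P1) (hP2 : supported_nonneg P2)
  (hL : forall j : 'I_n -> nat,
      laplace_stieltjes P1 (fun i => m i (j i)) =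
      laplace_stieltjes P2 (fun i => m i (j i))) :
  forall A : set (n.-tuple R), measurable A -> P1 A = P2 A.
Proof.
pose S i : set (R -> R) :=
  [set f | exists k, f = fun x => expR (- (m i k * x))].
have mpos i k : 0 < m i k.
  by elim: k => [|k /lt_trans]; [exact: m_pos|apply; exact: m_incr].
have SB i : S i `<=` nonneg_bounded_measurable.
  move=> _ [k ->]; split; first exact: measurable_expRN.
  exists 1 => x x0; have /andP[e0 e1] := expRN_ge0_le1 (ltW (mpos i k)) x0.
  by rewrite ger0_norm.
(* Choosing one base exponential per coordinate means choosing a multi-index [j], so this is exactly
   [hL]. *)
have SE f : (forall i, S i (f i)) ->
    (\int[P1]_(x in @orthant R n) (tuple_prod f x)%:E =
     \int[P2]_(x in @orthant R n) (tuple_prod f x)%:E)%E.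
  move=> /choice[j fE]; have := hL j; rewrite !laplace_stieltjesE//.
  by rewrite (_ : f = fun i y => expR (- (m i (j i) * y)))//; exact/funext.
have full : ray_boxes (R := R) (n := n) setT.
  by exists (fun=> setT); [left|apply/seteqP; split].
(* The whole space, itself a box of finite measure, serves as the constant exhausting sequence. *)
apply: (measure_unique (@ray_boxes R n) (fun=> setT)) => //.
- exact: measurable_ray_boxes.
- exact: ray_boxes_setI.
- exact: bigcup_const.
- move=> _ [J rJ ->]; have mJ i := measurable_ray_or_full (rJ i).
  apply: etrans (probability_boxE hP1 mJ) _.
  apply: etrans (esym (probability_boxE hP2 mJ)).
  apply: (bp_tuple_prod_eq SB SE) => i.
  exact: bp_muntz_ray.
- by move=> _; rewrite (le_lt_trans (probability_le1 _ _))// ltry.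
Qed.
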